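(* Consider the canonical symplectic form $\omega_0 = dr\wedge dP_r + d\alpha\wedge dP_\alpha$ of the planar restricted three-body problem, written in polar coordinates with their conjugate momenta $(r,\alpha,P_r,P_\alpha)\in(0,\infty)\times S^1\times\mathbb{R}^2$. Apply the (non-canonical) McGehee change of coordinates $r=\frac{2}{x^2}$, leaving $\alpha$, $P_r$ and $P_\alpha$ unchanged. That is, let $\Phi(x,\alpha,P_r,P_\alpha)=\left(\frac{2}{x^2},\alpha,P_r,P_\alpha\right)$ for $x\neq 0$. Then the pull-back of the symplectic form is $$\omega=\Phi^*\omega_0=-\frac{4}{x^3}\,dx\wedge dP_r+d\alpha\wedge dP_\alpha ,$$ and this expression defines a $b^3$-symplectic form on $M=\mathbb{R}\times S^1\times\mathbb{R}^2$ (with coordinates $(x,\alpha,P_r,P_\alpha)$) with critical hypersurface $Z=\{x=0\}$, the manifold at infinity.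
   Context: The angle $\alpha$ is the coordinate on $S^1=\mathbb{R}/2\pi\mathbb{Z}$. The configuration of the massless particle in the plane is $(r\cos\alpha,r\sin\alpha)$, and $P_r,P_\alpha$ are the momenta conjugate to $r,\alpha$. The limit $r\to\infty$ corresponds to $x\to 0$. $b^3$-forms: Let $M=\mathbb{R}\times S^1\times\mathbb{R}^2$ with coordinates $(x,\alpha,P_r,P_\alpha)$ and $Z=\{x=0\}$, with $x$ as the chosen defining function of $Z$. The $b^3$-tangent bundle ${}^{b^3}TM$ is the vector bundle whose smooth sections are the vector fields in the free $C^\infty(M)$-module generated by $x^3\frac{\partial}{\partial x},\frac{\partial}{\partial \alpha},\frac{\partial}{\partial P_r},\frac{\partial}{\partial P_\alpha}$. Its dual ${}^{b^3}T^*M$ has the frame $\frac{dx}{x^3},d\alpha,dP_r,dP_\alpha$. A $b^3$-form of degree $k$ is a smooth section of $\Lambda^k({}^{b^3}T^*M)$. Every such form can be written as $\omega=\frac{dx}{x^3}\wedge\eta+\beta$ with $\eta,\beta$ smooth differential forms on $M$ of degrees $k-1$ and $k$. The exterior derivative extends to $b^3$-forms by $d\omega=-\frac{dx}{x^3}\wedge d\eta+d\beta$, and agrees with the usual one on $M\setminus Z$. A $b^3$-symplectic form on $(M,Z)$ is a $b^3$-form $\omega$ of degree $2$ with $d\omega=0$ such that $\omega_p$ has maximal rank as an element of $\Lambda^2({}^{b^3}T_p^*M)$ for every $p\in M$. *)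

(* Defs.v *)
From HB Require Import structures.
From mathcomp Require Import all_boot all_order all_algebra.
From mathcomp Require Import all_classical all_reals all_analysis.
Set Implicit Arguments.
Unset Strict Implicit.
Unset Printing Implicit Defensive.
Import Order.TTheory GRing.Theory Num.Theory.
Import numFieldNormedType.Exports.
Local Open Scope classical_set_scope.
Local Open Scope ring_scope.

(** ** The circle R/2πZ and the cylinder R × S^1 × R^2 *)

Definition periods (R : realType) : {pred R} :=
  fun t => `[< exists k : int, t = k%:~R * (2 * pi) >].

Fact periods_zmod_closed (R : realType) : zmod_closed (@periods R).
Proof.
split; first by apply/asboolP; exists 0; rewrite mul0r.
move=> x y /asboolP[k ->] /asboolP[l ->]; apply/asboolP.
by exists (k - l); rewrite intrB mulrBl.
Qed.
HB.instance Definition _ (R : realType) :=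
  GRing.isZmodClosed.Build R (@periods R) (@periods_zmod_closed R).

Definition circle (R : realType) : Type := Quotient.quot (@periods R).

Definition angle (R : realType) (t : R) : circle R :=
  (\pi_(Quotient.quot (@periods R)) t)%qT.

(* The cylinder is used both for M, with first coordinate x, and for the
   phase space in polar coordinates, with first coordinate r > 0. *)
Record cylinder (R : realType) := Cylinder {
  radial : R; angular : circle R; mom_r : R; mom_a : R }.

Definition i_rad : 'I_4 := @Ordinal 4 0 isT.
Definition i_ang : 'I_4 := @Ordinal 4 1 isT.
Definition i_Pr : 'I_4 := @Ordinal 4 2 isT.
Definition i_Pa : 'I_4 := @Ordinal 4 3 isT.

Definition vec4 (R : realType) (a b c d : R) : 'rV[R]_4 :=
  \row_(j < 4) nth 0 [:: a; b; c; d] j.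

(* The universal covering R^4 -> R × S^1 × R^2. *)
Definition covering (R : realType) (u : 'rV[R]_4) : cylinder R :=
  Cylinder (u ord0 i_rad) (angle (u ord0 i_ang)) (u ord0 i_Pr) (u ord0 i_Pa).

(* Coordinates of the circle centred at angle c: the determination of the
   angle in [c - π, c + π). *)
Definition angle_chart (R : realType) (c : R) (a : circle R) : R :=
  xget 0 [set t | c - pi <= t < c + pi /\ angle t = a].

Definition angle_rep (R : realType) (a : circle R) : R := angle_chart 0 a.

Definition chart (R : realType) (c : R) (p : cylinder R) : 'rV[R]_4 :=
  vec4 (radial p) (angle_chart c (angular p)) (mom_r p) (mom_a p).

(* A preferred point of the fibre of [covering] over p. *)
Definition cover_rep (R : realType) (p : cylinder R) : 'rV[R]_4 :=
  chart 0 p.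

(** ** Calculus on the cylinder *)

(* The tangent space at each point is 'rV[R]_4, coordinates being taken in
   the frame of coordinate vector fields.  Since F \o covering is periodic,
   the derivative does not depend on the point chosen above p. *)
Definition dir_derive (R : realType) (F : cylinder R -> R) (v : 'rV[R]_4)
    (p : cylinder R) : R :=
  'D_v (F \o @covering R) (cover_rep p).

Fixpoint class_C (R : realType) (k : nat) (f : 'rV[R]_4 -> R) : Prop :=
  if k is k'.+1 then
    continuous f /\
    forall i : 'I_4, (forall u, derivable f u (delta_mx ord0 i)) /\
      class_C k' (fun u => 'D_(delta_mx ord0 i) f u)
  else continuous f.

Definition smooth (R : realType) (F : cylinder R -> R) : Prop :=
  forall k, class_C k (F \o @covering R).

(* The differential of F at p; the angular coordinate of the target is read
   in a chart centred at the angle of F p. *)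
Definition tangent_map (R : realType) (F : cylinder R -> cylinder R)
    (p : cylinder R) (v : 'rV[R]_4) : 'rV[R]_4 :=
  'D_v (fun u => chart (angle_rep (angular (F p))) (F (covering u))) (cover_rep p).

(** ** Fields of alternating forms *)

(* Both TM and the b^3-tangent bundle are trivialised by a global frame, so
   a k-linear form at p is a function of k row vectors, stored as the rows
   of a k × 4 matrix. *)
Definition form_field (R : realType) (k : nat) :=
  cylinder R -> 'M[R]_(k, 4) -> R.

Definition multilinear_form (R : realType) (k : nat) (f : 'M[R]_(k, 4) -> R) :=
  forall (A B C : 'M[R]_(k, 4)) (i : 'I_k) (b c : R),
    row i A = b *: row i B + c *: row i C ->
    row' i B = row' i A -> row' i C = row' i A ->
    f A = b * f B + c * f C.

Definition alternating_form (R : realType) (k : nat) (f : 'M[R]_(k, 4) -> R) :=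
  forall (A : 'M[R]_(k, 4)) (i j : 'I_k),
    i != j -> row i A = row j A -> f A = 0.

Definition smooth_form (R : realType) (k : nat) (w : form_field R k) : Prop :=
  [/\ forall p, multilinear_form (w p),
      forall p, alternating_form (w p)
    & forall v, smooth (fun p => w p v)].

(* The element of the dual frame with index i. *)
Definition coframe (R : realType) (i : 'I_4) : form_field R 1 :=
  fun _ v => v ord0 i.
Arguments coframe : clear implicits.

Definition form_add (R : realType) (k : nat) (w t : form_field R k)
    : form_field R k :=
  fun p v => w p v + t p v.

Definition form_scale (R : realType) (k : nat) (F : cylinder R -> R)
    (w : form_field R k) : form_field R k :=
  fun p v => F p * w p v.

Definition form_zero (R : realType) (k : nat) : form_field R k := fun _ _ => 0.
Arguments form_zero : clear implicits.

(* Exterior product of a 1-form with a k-form. *)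
Definition wedge1 (R : realType) (k : nat) (t : form_field R 1)
    (w : form_field R k) : form_field R k.+1 :=
  fun p v => \sum_(i < k.+1) (-1) ^+ i * t p (row i v) * w p (row' i v).

(* The exterior derivative of an ordinary form, by the invariant formula on
   constant (hence commuting) vector fields. *)
Definition ext_d (R : realType) (k : nat) (w : form_field R k)
    : form_field R k.+1 :=
  fun p v => \sum_(i < k.+1)
    (-1) ^+ i * dir_derive (fun q => w q (row' i v)) (row i v) p.

Definition pullback (R : realType) (k : nat) (F : cylinder R -> cylinder R)
    (w : form_field R k) : form_field R k :=
  fun p v => w (F p) (\matrix_(i < k) tangent_map F p (row i v)).

(* The rank of a 2-form at a point is that of its Gram matrix in the frame. *)
Definition form_rank (R : realType) (f : 'M[R]_(2, 4) -> R) : nat :=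
  \rank (\matrix_(i < 4, j < 4)
    f (col_mx (delta_mx ord0 i : 'rV[R]_4) (delta_mx ord0 j : 'rV[R]_4))).

(** ** b^3-forms on (M, Z), Z = {x = 0} *)

(* A fibre of the b^3-tangent bundle is 'rV[R]_4 in the frame x^3 d/dx, d/dα,
   d/dP_r, d/dP_α, so that a b^3-form is a [form_field] whose arguments
   are coordinates in that frame.  The natural map from the b^3-tangent bundle
   to TM has the following matrix (acting on row vectors); it is invertible
   off Z. *)
Definition anchor_mx (R : realType) (p : cylinder R) : 'M[R]_4 :=
  diag_mx (vec4 (radial p ^+ 3) 1 1 1).

(* An ordinary form regarded as a b^3-form. *)
Definition b3_of_form (R : realType) (k : nat) (w : form_field R k)
    : form_field R k :=
  fun p v => w p (v *m anchor_mx p).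

Definition b3_dx (R : realType) : form_field R 1 := coframe R i_rad.
Arguments b3_dx : clear implicits.

(* dx/x^3 /\ eta + beta. *)
Definition b3_compose (R : realType) (k : nat) (eta : form_field R k)
    (beta : form_field R k.+1) : form_field R k.+1 :=
  form_add (wedge1 (b3_dx R) (b3_of_form eta)) (b3_of_form beta).

(* [is_b3_d w t] : t is the exterior derivative of the b^3-form w.  The pair
   (eta, beta) is not unique, but t does not depend on it, because
   the formula gives the usual d off Z, which is dense. *)
Definition is_b3_d (R : realType) (k : nat) (w : form_field R k.+1)
    (t : form_field R k.+2) : Prop :=
  exists (eta : form_field R k) (beta : form_field R k.+1),
    [/\ smooth_form eta, smooth_form beta, w = b3_compose eta beta
      & t = b3_compose (form_scale (fun=> -1) (ext_d eta)) (ext_d beta)].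

Definition b3_symplectic (R : realType) (w : form_field R 2) : Prop :=
  [/\ smooth_form w, is_b3_d w (form_zero R 3)
    & forall p, form_rank (w p) = 4%N].

(** ** The McGehee change of coordinates *)

Definition Z_infty (R : realType) : set (cylinder R) :=
  [set p | radial p = 0].
Arguments Z_infty : clear implicits.

Definition polar_phase_space (R : realType) : set (cylinder R) :=
  [set p | 0 < radial p].
Arguments polar_phase_space : clear implicits.

(* dr /\ dP_r + dα /\ dP_α *)
Definition omega_0 (R : realType) : form_field R 2 :=
  form_add (wedge1 (coframe R i_rad) (coframe R i_Pr))
           (wedge1 (coframe R i_ang) (coframe R i_Pa)).
Arguments omega_0 : clear implicits.

(* Meaningful only off Z_infty. *)
Definition mcgehee (R : realType) (p : cylinder R) : cylinder R :=
  Cylinder (2 / radial p ^+ 2) (angular p) (mom_r p) (mom_a p).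

(* - (4 / x^3) dx /\ dP_r + dα /\ dP_α as an ordinary form, off Z_infty. *)
Definition mcgehee_form (R : realType) : form_field R 2 :=
  form_add
    (form_scale (fun p => - (4 / radial p ^+ 3))
      (wedge1 (coframe R i_rad) (coframe R i_Pr)))
    (wedge1 (coframe R i_ang) (coframe R i_Pa)).
Arguments mcgehee_form : clear implicits.

(* The same expression read as a b^3-form on M: - 4 (dx/x^3) /\ dP_r
   + dα /\ dP_α. *)
Definition mcgehee_b3_form (R : realType) : form_field R 2 :=
  form_add
    (form_scale (fun=> -4) (wedge1 (b3_dx R) (coframe R i_Pr)))
    (wedge1 (coframe R i_ang) (coframe R i_Pa)).
Arguments mcgehee_b3_form : clear implicits.

(* Main.v *)
Require Import Defs.
From mathcomp Require Import all_boot all_order all_algebra.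
From mathcomp Require Import all_classical all_reals all_analysis.
From mathcomp Require Import ring lra.
Import Order.TTheory GRing.Theory Num.Theory.
Import numFieldNormedType.Exports.
Local Open Scope classical_set_scope.
Local Open Scope ring_scope.

(** Near the chosen lift of a point, the angular coordinate read in the chart
    centred at its own angle is the identity, so d(2/x^2) = - (4/x^3) dx gives
    the pull-back.  As a b^3-form the result is dx/x^3 /\ (-4 dP_r)
    + dα /\ dP_α: its coefficients in the b^3-frame are constant, so it is
    smooth and closed, and its Gram matrix is the same invertible matrix at
    every point, including those of Z. *)

(** * Angular charts on the circle *)

Lemma angle_eq_period (R : realType) (s t : R) :
  angle s = angle t -> exists k : int, s - t = k%:~R * (2 * pi).
Proof.
move=> /eqP; rewrite /angle -Quotient.idealrBE => /asboolP[k hk].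
by exists k.
Qed.

(** Two lifts of one angle differ by an integer multiple of 2π. Two points of a half-open window of
    length 2π are less than 2π apart, so that integer is 0 and the choice made by [xget] is
    forced. *)
Lemma angle_chartK (R : realType) (c t : R) :
  c - pi <= t < c + pi -> angle_chart c (angle t) = t.
Proof.
move=> ht; apply: xget_unique => [//|s [hs /angle_eq_period[k hk]]].
have pi0 := pi_gt0 R.
suff k0 : k = 0 by move: hk; rewrite k0 mul0r => /subr0_eq.
have : `|k%:~R * (2 * pi)| < 2 * pi :> R.
  by rewrite -hk ltr_norml; move: ht hs => /andP[? ?] /andP[? ?]; lra.
have tp0 : 0 < 2 * pi :> R by lra.
rewrite normrM (gtr0_norm tp0) -[X in _ < X -> _]mul1r ltr_pM2r //.
by rewrite -intr_norm ltrz1; case: k {hk} => [[|n]|n].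
Qed.

(** * The differential of the McGehee map in coordinates *)

Lemma vec4E (R : realType) (a b c d : R) :
  (vec4 a b c d ord0 i_rad = a) * (vec4 a b c d ord0 i_ang = b) *
  (vec4 a b c d ord0 i_Pr = c) * (vec4 a b c d ord0 i_Pa = d).
Proof. by rewrite !mxE. Qed.

(** Plain case analysis on ['I_4] leaves ordinals with arbitrary bound proofs; this eliminator
    returns the named indices, on which [vec4E] rewrites. *)
Lemma ord4_ind (P : 'I_4 -> Prop) :
  P i_rad -> P i_ang -> P i_Pr -> P i_Pa -> forall j, P j.
Proof.
move=> h0 h1 h2 h3 [[|[|[|[|//]]]] hj].
- by rewrite (_ : Ordinal hj = i_rad) //; apply: val_inj.
- by rewrite (_ : Ordinal hj = i_ang) //; apply: val_inj.
- by rewrite (_ : Ordinal hj = i_Pr) //; apply: val_inj.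
- by rewrite (_ : Ordinal hj = i_Pa) //; apply: val_inj.
Qed.

Lemma is_derive_coord (R : realType) (n : nat) (j : 'I_n) (a v : 'rV[R]_n) :
  is_derive a v (fun u : 'rV[R]_n => u ord0 j) (v ord0 j).
Proof.
have hid : derivable (@id 'rV[R]_n) a v by exact: derivable_id.
split; first exact: (derivable_mxP _ _ _).1 hid ord0 j.
by have /rowP/(_ j) := derive_mx hid; rewrite derive_id !mxE.
Qed.

Lemma is_derive_mcgehee_radius (R : realType) (n : nat) (j : 'I_n)
    (a v : 'rV[R]_n) : a ord0 j != 0 ->
  is_derive a v (fun u : 'rV[R]_n => 2 / u ord0 j ^+ 2)
    (- (4 / a ord0 j ^+ 3) * v ord0 j).
Proof.
move=> a0; pose f (u : 'rV[R]_n) : R := u ord0 j.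
have [dX eX] : is_derive a v f (v ord0 j) := is_derive_coord R n j a v.
(* The square is taken in the ring of functions, the form that the derivation rules for powers and
   inverses expect; [f2E] returns to pointwise values. *)
have f2E u : (f ^+ 2) u = u ord0 j ^+ 2 by rewrite expr2.
have f20 : (f ^+ 2) a != 0 by rewrite f2E expf_neq0.
have dX2 : derivable (f ^+ 2) a v by exact: derivableX.
have dV := derivableV f20 dX2.
have -> : (fun u : 'rV[R]_n => 2 / u ord0 j ^+ 2) =
    2 \*: (fun u => ((f ^+ 2) u)^-1) by apply/funext => u; rewrite /= f2E.
split; first exact: derivableZ.
rewrite deriveZ // deriveV // (deriveX _ dX) eX f2E /f.
by rewrite /GRing.scale /=; field.
Qed.

Lemma tangent_map_mcgehee (R : realType) (p : cylinder R) (v : 'rV[R]_4) :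
  ~ Z_infty R p ->
  tangent_map (@mcgehee R) p v =
  vec4 (- (4 / radial p ^+ 3) * v ord0 i_rad)
    (v ord0 i_ang) (v ord0 i_Pr) (v ord0 i_Pa).
Proof.
move=> /eqP p0; set c := angle_rep (angular p).
rewrite /tangent_map /= -/c.
pose f (u : 'rV[R]_4) : 'rV[R]_4 := vec4 (2 / u ord0 i_rad ^+ 2)
  (u ord0 i_ang) (u ord0 i_Pr) (u ord0 i_Pa).
have hx : cover_rep p ord0 i_rad = radial p by rewrite vec4E.
have hc : cover_rep p ord0 i_ang = c by rewrite vec4E.
(* The derivative depends only on the germ at the lift. The McGehee map keeps the angle, so the
   chart is centred at the angular coordinate [c] of the lift itself; nearby angles stay strictly
   within π of [c], and [angle_chartK] removes the chart. *)
rewrite (near_eq_derive (g := f)); last first.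
  have hcont : (fun u : 'rV[R]_4 => u ord0 i_ang) @ cover_rep p --> c.
    by rewrite -hc; exact: coord_continuous.
  have pi0 := pi_gt0 R.
  have lo : \forall u \near (cover_rep p : 'rV[R]_4), c - pi < (u : 'rV[R]_4) ord0 i_ang.
    by apply: (cvgr_gt _ hcont); lra.
  have hi : \forall u \near (cover_rep p : 'rV[R]_4), (u : 'rV[R]_4) ord0 i_ang < c + pi.
    by apply: (cvgr_lt _ hcont); lra.
  near=> u.
  rewrite /f /chart /= angle_chartK //.
  by apply/andP; split; [apply: ltW|]; near: u.
have df j : is_derive (cover_rep p) v (fun u => f u ord0 j)
    (vec4 (- (4 / radial p ^+ 3) * v ord0 i_rad)
    (v ord0 i_ang) (v ord0 i_Pr) (v ord0 i_Pa) ord0 j).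
  elim/ord4_ind: j; rewrite !vec4E.
  - under eq_fun do rewrite vec4E.
    by rewrite -hx; apply: is_derive_mcgehee_radius; rewrite hx.
  - by under eq_fun do rewrite vec4E; exact: is_derive_coord.
  - by under eq_fun do rewrite vec4E; exact: is_derive_coord.
  - by under eq_fun do rewrite vec4E; exact: is_derive_coord.
rewrite derive_mx; last by apply/derivable_mxP => i j; rewrite ord1; case: (df j).
by apply/rowP => j; rewrite mxE; case: (df j).
Unshelve. all: by end_near.
Qed.

(** * Algebra of constant-coefficient forms *)

Lemma wedge1_coframeE (R : realType) (a b : 'I_4) (p : cylinder R)
    (v : 'M[R]_(2, 4)) :
  wedge1 (coframe R a) (coframe R b) p v =
  v ord0 a * v ord_max b - v ord_max a * v ord0 b.
Proof.
rewrite /wedge1 /coframe !big_ord_recl big_ord0 !mxE /= addr0 expr0 expr1.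
rewrite mul1r !mulN1r mulNr.
by congr (v _ _ * v _ _ - v _ _ * v _ _); apply: val_inj.
Qed.

Lemma class_C_cst (R : realType) (k : nat) (c : R) :
  class_C k (fun _ : 'rV[R]_4 => c).
Proof.
(* The constant is generalised because the partial derivatives are the constant 0. *)
elim: k c => [|k IH] c /=; first exact: cst_continuous.
split=> [|i]; first exact: cst_continuous.
split=> [u|]; first exact: derivable_cst.
under eq_fun do rewrite derive_cst.
exact: IH.
Qed.

Lemma smooth_constant_form (R : realType) (k : nat) (f : 'M[R]_(k, 4) -> R) :
  multilinear_form f -> alternating_form f -> smooth_form (fun _ => f).
Proof. by move=> mf af; split=> // v m; exact: class_C_cst. Qed.

Lemma ext_d_constant_form (R : realType) (k : nat) (f : 'M[R]_(k, 4) -> R) :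
  ext_d (fun _ => f) = form_zero R k.+1.
Proof.
apply/funext => p; apply/funext => v; rewrite /ext_d big1 // => i _.
by rewrite /dir_derive derive_cst mulr0.
Qed.

Lemma multilinear_form_coframe (R : realType) (a : 'I_4) (p : cylinder R) :
  multilinear_form (coframe R a p).
Proof.
move=> A B C i b c /rowP/(_ a); rewrite !ord1 !mxE => hA _ _.
by rewrite /coframe hA.
Qed.

Lemma alternating_form1 (R : realType) (f : 'M[R]_(1, 4) -> R) :
  alternating_form f.
Proof. by move=> A i j; rewrite !ord1. Qed.

Lemma multilinear_form_wedge1_coframe (R : realType) (a b : 'I_4)
    (p : cylinder R) :
  multilinear_form (wedge1 (coframe R a) (coframe R b) p).
Proof.
move=> A B C i x y hA /matrixP hB /matrixP hC; rewrite !wedge1_coframeE.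
have hAi d : A i d = x * B i d + y * C i d.
  by have /rowP/(_ d) := hA; rewrite !mxE.
(* An index other than [i] is [lift i k] for some [k], hence a row kept by [row' i]. *)
have hBi d j : j != i -> B j d = A j d.
  by case: (unliftP i j) => [k -> _|-> /eqP//]; have := hB k d; rewrite !mxE.
have hCi d j : j != i -> C j d = A j d.
  by case: (unliftP i j) => [k -> _|-> /eqP//]; have := hC k d; rewrite !mxE.
have [i0|i1] : i = ord0 \/ i = ord_max.
  by case: i {hA hB hC hAi hBi hCi} => [[|[|//]] hi]; [left|right]; apply: val_inj.
- by subst i; rewrite !hAi !(hBi _ ord_max) // !(hCi _ ord_max) //; ring.
- by subst i; rewrite !hAi !(hBi _ ord0) // !(hCi _ ord0) //; ring.
Qed.

Lemma alternating_form_wedge1_coframe (R : realType) (a b : 'I_4)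
    (p : cylinder R) :
  alternating_form (wedge1 (coframe R a) (coframe R b) p).
Proof.
move=> A i j ij hA; rewrite wedge1_coframeE.
have h d : A ord0 d = A ord_max d.
  have /rowP/(_ d) := hA; rewrite !mxE.
  case: i j ij {hA} => [[|[|//]] hi] [[|[|//]] hj] //= _ h.
  - by move: h; congr (A _ _ = A _ _); apply: val_inj.
  - by move: (esym h); congr (A _ _ = A _ _); apply: val_inj.
by rewrite !h; ring.
Qed.

Lemma multilinear_form_add (R : realType) (k : nat) (w t : form_field R k)
    (p : cylinder R) :
  multilinear_form (w p) -> multilinear_form (t p) ->
  multilinear_form (form_add w t p).
Proof.
move=> mw mt A B C i b c hA hB hC.
by rewrite /form_add (mw _ _ _ _ _ _ hA) // (mt _ _ _ _ _ _ hA) //; ring.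
Qed.

Lemma multilinear_form_scale (R : realType) (k : nat) (F : cylinder R -> R)
    (w : form_field R k) (p : cylinder R) :
  multilinear_form (w p) -> multilinear_form (form_scale F w p).
Proof.
move=> mw A B C i b c hA hB hC.
by rewrite /form_scale (mw _ _ _ _ _ _ hA) //; ring.
Qed.

Lemma alternating_form_add (R : realType) (k : nat) (w t : form_field R k)
    (p : cylinder R) :
  alternating_form (w p) -> alternating_form (t p) ->
  alternating_form (form_add w t p).
Proof.
move=> altw altt A i j ij hA.
by rewrite /form_add (altw _ _ _ ij) // (altt _ _ _ ij) // addr0.
Qed.

Lemma alternating_form_scale (R : realType) (k : nat) (F : cylinder R -> R)
    (w : form_field R k) (p : cylinder R) :
  alternating_form (w p) -> alternating_form (form_scale F w p).
Proof. by move=> aw A i j ij hA; rewrite /form_scale (aw _ _ _ ij) // mulr0. Qed.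

(** * The McGehee form as an ordinary form and as a b^3-form *)

Lemma mul_anchor_mxE (R : realType) (k : nat) (v : 'M[R]_(k, 4))
    (p : cylinder R) (i : 'I_k) :
  ((v *m anchor_mx p) i i_rad = v i i_rad * radial p ^+ 3) *
  ((v *m anchor_mx p) i i_ang = v i i_ang) *
  ((v *m anchor_mx p) i i_Pr = v i i_Pr) *
  ((v *m anchor_mx p) i i_Pa = v i i_Pa).
Proof. by rewrite /anchor_mx mul_mx_diag !mxE /= !mulr1. Qed.

(** The anchor rescales only the radial component, which this form does not see. *)
Lemma b3_of_form_wedge1_ang_Pa (R : realType) :
  b3_of_form (wedge1 (coframe R i_ang) (coframe R i_Pa)) =
  wedge1 (coframe R i_ang) (coframe R i_Pa).
Proof.
apply/funext => p; apply/funext => v.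
by rewrite /b3_of_form !wedge1_coframeE !mul_anchor_mxE.
Qed.

Lemma pullback_mcgehee_omega_0 (R : realType) (p : cylinder R) :
  ~ Z_infty R p -> pullback (@mcgehee R) (omega_0 R) p = mcgehee_form R p.
Proof.
move=> p0; apply/funext => v.
rewrite /pullback /omega_0 /mcgehee_form /form_add /form_scale.
rewrite !wedge1_coframeE !mxE !tangent_map_mcgehee // !vec4E.
by rewrite !mxE; ring.
Qed.

(** The factor x^3 that the anchor puts on the radial component cancels the denominator of -4/x^3,
    leaving the coefficient -4. *)
Lemma mcgehee_b3_form_off_Z (R : realType) (p : cylinder R) :
  ~ Z_infty R p -> mcgehee_b3_form R p = b3_of_form (mcgehee_form R) p.
Proof.
move=> /eqP p0; apply/funext => v.
rewrite /b3_of_form /mcgehee_b3_form /mcgehee_form /form_add /form_scale.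
rewrite /b3_dx !wedge1_coframeE !mul_anchor_mxE.
by field.
Qed.

Lemma smooth_mcgehee_b3_form (R : realType) : smooth_form (mcgehee_b3_form R).
Proof.
(* The base point is arbitrary: the field ignores its point, so it is convertible to the constant
   field with this value. *)
apply: (@smooth_constant_form _ _ (mcgehee_b3_form R (Cylinder 0 (angle 0) 0 0))).
- apply: multilinear_form_add; last exact: multilinear_form_wedge1_coframe.
  apply: multilinear_form_scale; exact: multilinear_form_wedge1_coframe.
- apply: alternating_form_add; last exact: alternating_form_wedge1_coframe.
  apply: alternating_form_scale; exact: alternating_form_wedge1_coframe.
Qed.

Lemma closed_mcgehee_b3_form (R : realType) :
  is_b3_d (mcgehee_b3_form R) (form_zero R 3).
Proof.
pose eta := form_scale (fun=> -4) (coframe R i_Pr).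
pose beta := wedge1 (coframe R i_ang) (coframe R i_Pa).
pose q : cylinder R := Cylinder 0 (angle 0) 0 0.
exists eta, beta; split.
- apply: (@smooth_constant_form _ _ (eta q)); last exact: alternating_form1.
  exact/multilinear_form_scale/multilinear_form_coframe.
- apply: (@smooth_constant_form _ _ (beta q)).
    exact: multilinear_form_wedge1_coframe.
  exact: alternating_form_wedge1_coframe.
- rewrite /b3_compose b3_of_form_wedge1_ang_Pa /mcgehee_b3_form.
  congr form_add; apply/funext => p; apply/funext => v.
  rewrite /form_scale /wedge1 mulr_sumr; apply: eq_bigr => i _.
  (* The anchor fixes the P_r component, so [eta] is unchanged as a b^3-form. *)
  by rewrite /b3_of_form /eta /form_scale /coframe mul_anchor_mxE; ring.
- have -> : ext_d eta = form_zero R 2 by exact: (@ext_d_constant_form _ _ (eta q)).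
  have -> : ext_d beta = form_zero R 3 by exact: (@ext_d_constant_form _ _ (beta q)).
  apply/funext => p; apply/funext => v.
  rewrite /b3_compose /form_add /wedge1 /b3_of_form /form_scale /form_zero.
  by rewrite big1 ?addr0 // => i _; rewrite !mulr0.
Qed.

Lemma rank_mcgehee_b3_form (R : realType) (p : cylinder R) :
  form_rank (mcgehee_b3_form R p) = 4%N.
Proof.
rewrite /form_rank; set A := (X in mxrank X).
(* [N] is the inverse of the Gram matrix, which pairs x with P_r by a block with entries -4 and 4,
   and α with P_α by a block with entries 1 and -1. Each block is inverted separately; a one-sided
   inverse of a square matrix already gives full rank. *)
pose N : 'M[R]_4 := \matrix_(i, j)
  (((i == i_Pr) && (j == i_rad))%:R * - 4^-1
   + ((i == i_rad) && (j == i_Pr))%:R * 4^-1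
   + ((i == i_Pa) && (j == i_ang))%:R - ((i == i_ang) && (j == i_Pa))%:R).
suff /mulmx1_unit[uA _] : A *m N = 1%:M by apply: mxrank_unit.
have AE i j : A i j = -4 * ((i == i_rad)%:R * (j == i_Pr)%:R
    - (j == i_rad)%:R * (i == i_Pr)%:R)
    + ((i == i_ang)%:R * (j == i_Pa)%:R - (j == i_ang)%:R * (i == i_Pa)%:R).
  rewrite mxE /mcgehee_b3_form /form_add /form_scale /b3_dx !wedge1_coframeE.
  have up (x y : 'rV[R]_4) k :
      (col_mx x y : 'M[R]_(2, 4)) ord0 k = x ord0 k.
    by rewrite -(col_mxEu x y); congr (col_mx _ _ _ _); apply: val_inj.
  have down (x y : 'rV[R]_4) k :
      (col_mx x y : 'M[R]_(2, 4)) ord_max k = y ord0 k.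
    by rewrite -(col_mxEd x y); congr (col_mx _ _ _ _); apply: val_inj.
  by rewrite !up !down !mxE /= ![_ == i]eq_sym ![_ == j]eq_sym.
apply/matrixP => i j; rewrite mxE.
under eq_bigr do rewrite AE mxE.
rewrite !big_ord_recl big_ord0 mxE.
(* The sixteen entries of the product are checked one by one. *)
by elim/ord4_ind: i; elim/ord4_ind: j; rewrite /=; field.
Qed.

Theorem mainTheorem1 (R : realType) :
  (forall p : cylinder R, ~ Z_infty R p ->
     polar_phase_space R (mcgehee p) /\
     pullback (@mcgehee R) (omega_0 R) p = mcgehee_form R p) /\
  b3_symplectic (mcgehee_b3_form R) /\
  (forall p : cylinder R, ~ Z_infty R p ->
     mcgehee_b3_form R p = b3_of_form (mcgehee_form R) p).
Proof.
split=> [p p0|].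
  split; last exact: pullback_mcgehee_omega_0.
  rewrite /polar_phase_space /= divr_gt0 // exprn_even_gt0 //=.
  exact/eqP.
split; last by move=> p; exact: mcgehee_b3_form_off_Z.
split; first exact: smooth_mcgehee_b3_form.
  exact: closed_mcgehee_b3_form.
exact: rank_mcgehee_b3_form.
Qed.
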